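(* Assume the Shub–Smale hypothesis holds. Then there is no polynomial $q$ such that for every $n\ge 1$ the binary value principle $\mathrm{BVP}_n$ has a constant-free boolean IPS refutation over $\mathbb{Q}$ of size at most $q(n)$.
   Context: An algebraic circuit over a ring $R$ is a finite directed acyclic graph whose in-degree-0 nodes are labelled by variables or by elements of $R$ and whose other nodes have in-degree 2 and are labelled $+$ or $\times$; it computes a polynomial in the usual way, and its size is its number of nodes. It is constant-free if the only ring elements labelling leaves are $0,1,-1$. A constant-free circuit over $\mathbb{Q}$ is a constant-free circuit that may additionally contain division gates $u\div v$, where the subcircuit rooted at $v$ contains no variables and computes a nonzero constant. For an integer $m$ (or $f\in\mathbb{Z}[\bar x]$), $\tau(m)$ is the minimal size of a constant-free division-free circuit computing $m$. Shub–Smale hypothesis: for every sequence $(m_n)_{n\in\mathbb{N}}$ of nonzero integers, the sequence $(m_n\cdot n!)_{n}$ is not easy, where a sequence $(a_n)$ is easy if there is a constant $c$ with $\tau(a_n)\le (\log n)^c$ for all $n>2$. Boolean IPS over a field $\mathbb{F}$: given $f_1,\dots,f_m,p\in\mathbb{F}[x_1,\dots,x_n]$, an IPS proof of $p$ from $\{f_j=0\}$ is an algebraic circuit $C(\bar x,y_1,\dots,y_m,z_1,\dots,z_n)$ such that, as formal polynomial identities, $C(\bar x,\bar 0,\bar 0)=0$ and $C(\bar x,f_1,\dots,f_m,x_1^2-x_1,\dots,x_n^2-x_n)=p$; its size is the size of $C$; a refutation is a proof of $p=1$; it is constant-free over $\mathbb{Q}$ if $C$ is a constant-free circuit over $\mathbb{Q}$.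 $\mathrm{BVP}_n$ is the single equation $\sum_{i=1}^n 2^{i-1}x_i+1=0$ (i.e. $f_1=1+\sum_{i=1}^n2^{i-1}x_i$). *)

(* Defs.v *)
From Stdlib Require Import Reals.
From mathcomp Require Import all_boot all_order all_algebra.
From mathcomp Require Import boolp mpoly.

Set Implicit Arguments.
Unset Strict Implicit.
Unset Printing Implicit Defensive.

Import GRing.Theory.
Local Open Scope ring_scope.

(* Node labels, over the variables 'X_i with i : 'I_k.  The natural-number
   arguments are the (ordered) children of a node, given by their positions in
   the list of nodes. *)
Inductive gate (R : Type) (k : nat) : Type :=
| Var of 'I_k
| Cst of R
| Add of nat & nat
| Mul of nat & nat
| Div of nat & nat.

Arguments Var {R k} _.
Arguments Cst {R k} _.
Arguments Add {R k} _ _.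
Arguments Mul {R k} _ _.
Arguments Div {R k} _ _.

Section Circuits.
Variables (R : comUnitRingType) (k : nat).

Definition children (g : gate R k) : seq nat :=
  match g with
  | Var _ | Cst _ => [::]
  | Add i j | Mul i j | Div i j => [:: i; j]
  end.

(* Acyclicity: the list of nodes is a topological sort of the graph. *)
Definition topological (gs : seq (gate R k)) : bool :=
  all (fun ig => all (fun j => (j < ig.1)%N) (children ig.2))
      (zip (iota 0 (size gs)) gs).

Record circuit : Type := Circuit {
  nodes : seq (gate R k);
  output : nat;
  nodes_topological : topological nodes;
  output_lt : (output < size nodes)%N }.

Definition circuit_size (C : circuit) : nat := size (nodes C).

Definition node_labels (T : Type) (step : seq T -> gate R k -> T)
    (gs : seq (gate R k)) : seq T :=
  foldl (fun acc g => rcons acc (step acc g)) [::] gs.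

(* A quotient is formed by inverting the constant coefficient of the divisor;
   [lawful_divisions] below requires the divisor to be a nonzero constant. *)
Definition gate_value (vs : seq {mpoly R[k]}) (g : gate R k) : {mpoly R[k]} :=
  match g with
  | Var i => 'X_i
  | Cst a => a%:MP_[k]
  | Add i j => nth 0 vs i + nth 0 vs j
  | Mul i j => nth 0 vs i * nth 0 vs j
  | Div i j => (mcoeff 0%MM (nth 0 vs j))^-1 *: nth 0 vs i
  end.

Definition node_values : seq (gate R k) -> seq {mpoly R[k]} :=
  node_labels gate_value.

Definition gate_var_free (bs : seq bool) (g : gate R k) : bool :=
  match g with
  | Var _ => false
  | Cst _ => true
  | Add i j | Mul i j | Div i j => nth true bs i && nth true bs j
  end.

(* The [j]-th entry tells whether the subcircuit rooted at node [j] contains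
   no variables. *)
Definition nodes_var_free : seq (gate R k) -> seq bool :=
  node_labels gate_var_free.

Definition circuit_poly (C : circuit) : {mpoly R[k]} :=
  nth 0 (node_values (nodes C)) (output C).

Definition lawful_divisions (C : circuit) : bool :=
  all (fun g => if g is Div _ j then
                  nth false (nodes_var_free (nodes C)) j
                  && (nth 0 (node_values (nodes C)) j != 0)
                else true)
      (nodes C).

Definition division_free (C : circuit) : bool :=
  all (fun g => if g is Div _ _ then false else true) (nodes C).

Definition constant_leaves (C : circuit) : bool :=
  all (fun g => if g is Cst a then a \in [:: 0; 1; -1] else true) (nodes C).

End Circuits.

Definition constant_free (R : comUnitRingType) (k : nat) (C : circuit R k) :
    bool :=
  division_free C && constant_leaves C.

Definition constant_free_over_rat (k : nat) (C : circuit rat k) : bool :=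
  lawful_divisions C && constant_leaves C.

Definition computable_in_size (m : int) (s : nat) : Prop :=
  exists C : circuit int 0,
    [/\ constant_free C, circuit_poly C = m%:MP_[0] & circuit_size C = s].

Lemma computable_in_some_size (m : int) :
  exists s, `[< computable_in_size m s >].
Proof.
suff [C [cC vC]] : exists C : circuit int 0,
    constant_free C /\ circuit_poly C = m%:MP_[0].
  by exists (circuit_size C); apply/asboolP; exists C.
pose snoc gs (g : gate int 0) := rcons gs g.
have rcons_top gs (g : gate int 0) :
    topological gs -> all (fun j => (j < size gs)%N) (children g) ->
    topological (rcons gs g).
  rewrite /topological size_rcons -addn1 iotaD add0n cats1 zip_rcons ?size_iota //.
  by rewrite all_rcons /= => -> ->.
have size_val gs : size (node_values gs : seq {mpoly int[0]}) = size gs.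
  elim/last_ind: gs => [//|gs g IH].
  by rewrite /node_values /node_labels foldl_rcons !size_rcons -IH.
have val_rcons gs (g : gate int 0) :
    node_values (rcons gs g) = rcons (node_values gs) (gate_value (node_values gs) g).
  by rewrite /node_values /node_labels foldl_rcons.
have build (e : int) (n : nat) : e \in [:: 0; 1; -1] ->
    exists C : circuit int 0, [/\ constant_free C,
      circuit_poly C = (e *+ n)%:MP_[0] & output C = (size (nodes C)).-1].
  move=> he; elim: n => [|n [[gs o tgs ogs] [/= /andP[dC cC] vC eo]]].
    have t0 : topological [:: Cst 0 : gate int 0] by [].
    by exists (@Circuit int 0 [:: Cst 0] 0 t0 isT).
  pose gs1 := rcons gs (Cst e).
  have t1 : topological gs1 by apply: rcons_top.
  have t2 : topological (rcons gs1 (Add o (size gs))).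
    apply: rcons_top => //=; rewrite size_rcons ltnS leqnn andbT andbT.
    exact: leqW ogs.
  have o2 : (size gs1 < size (rcons gs1 (Add o (size gs) : gate int 0)))%N.
    by rewrite size_rcons.
  exists (Circuit t2 o2); split => /=; last by rewrite size_rcons.
    rewrite /constant_free /division_free /constant_leaves /= !all_rcons /= he.
    by apply/andP; split; [exact: dC | exact: cC].
  rewrite /circuit_poly /= in vC *.
  rewrite val_rcons nth_rcons size_val ltnn eqxx /= val_rcons !nth_rcons.
  by rewrite size_val ogs ltnn eqxx /= vC -mpolyCD mulrSr.
have {build} build (e : int) (n : nat) : e \in [:: 0; 1; -1] ->
    exists C : circuit int 0, constant_free C /\ circuit_poly C = (e *+ n)%:MP_[0].
  by move=> /build - /(_ n) [C [? ? _]]; exists C.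
case: m => n; first by have [] := build 1 n isT => C; rewrite pmulrn intz; exists C.
have [] := build (-1) n.+1 isT => C; rewrite mulNrn pmulrn intz -NegzE.
by exists C.
Qed.

Definition tau (m : int) : nat := ex_minn (computable_in_some_size m).

(* The base of the logarithm is immaterial: any base in (1, 3), in particular 2,
   makes log n > 1 for all n > 2 and gives the same notion up to changing [c]. *)
Definition easy (a : nat -> int) : Prop :=
  exists c : Rdefinitions.R, forall n : nat, (2 < n)%N ->
    Rle (INR (tau (a n))) (Rpower (ln (INR n)) c).

Definition Shub_Smale_hypothesis : Prop :=
  forall m : nat -> int, (forall n, m n != 0) ->
    ~ easy (fun n => m n * (n`!)%:Z).

Section BooleanIPS.
Variables (F : fieldType) (n m : nat).

Definition x_vars : n.-tuple {mpoly F[n]} := [tuple 'X_i | i < n].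

Definition boolean_axioms : n.-tuple {mpoly F[n]} :=
  [tuple 'X_i ^+ 2 - 'X_i | i < n].

(* The n + (m + n) variables of an IPS proof are, in order,
   x_1 .. x_n, y_1 .. y_m, z_1 .. z_n. *)
Definition boolean_ips_proof (f : m.-tuple {mpoly F[n]}) (p : {mpoly F[n]})
    (C : circuit F (n + (m + n))) : Prop :=
  comp_mpoly [tuple of x_vars ++ [tuple of nseq m 0 ++ nseq n 0]]
    (circuit_poly C) = 0
  /\ comp_mpoly [tuple of x_vars ++ [tuple of f ++ boolean_axioms]]
       (circuit_poly C) = p.

End BooleanIPS.

Definition constant_free_boolean_ips_refutation (n m : nat)
    (f : m.-tuple {mpoly rat[n]}) (C : circuit rat (n + (m + n))) : Prop :=
  constant_free_over_rat C /\ boolean_ips_proof f 1 C.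

(* Indices are shifted: 'X_i for i : 'I_n is the variable x_(i+1). *)
Definition BVP (n : nat) : 1.-tuple {mpoly rat[n]} :=
  [tuple 1 + \sum_(i < n) (2%:R ^+ i) *: 'X_i].

(* Main.v *)
(** A refutation C satisfies C(x, f, x^2 - x) = 1 and C(x, 0, 0) = 0, where
    f = 1 + sum_i 2^(i-1) x_i.  Pushing the divisions to the output writes
    C = N / M with N integral and M a nonzero integer; division gates only
    divide by variable-free nodes, so M does not depend on the variables and has
    a constant-free circuit of size linear in that of C.  At the binary digits b
    of a < 2^n we get N(b, 1 + a, 0) = M and N(b, 0, 0) = 0, hence 1 + a divides
    M.  Therefore (2^n)! divides M^(2^n), which n squarings compute from M, and
    for 2^(n-1) < k <= 2^n these are multiples of k! of complexity polynomial in
    log k, against the Shub-Smale hypothesis. *)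
From Stdlib Require Import Reals Lra.
Require Import Defs.
From mathcomp Require Import all_boot all_order all_algebra.
From mathcomp Require Import zify ring boolp mpoly.

Set Implicit Arguments.
Unset Strict Implicit.
Unset Printing Implicit Defensive.

Import Order.TTheory GRing.Theory Num.Theory.
Local Open Scope ring_scope.

(** * Real estimates: polynomials in the binary logarithm against powers of [ln] *)

Section RealBounds.
Local Open Scope R_scope.

(** Makes [ln 3] a base above 1, so that its powers can absorb any constant factor in
    [poly_log_bound]. *)
Lemma ln3_gt1 : 1 < ln 3.
Proof.
rewrite -[X in X < _]ln_exp; apply: ln_increasing; first exact: exp_pos.
(* exp 1 <= (10 / 9)^10 < 3; [exp_le_3] is not strict. *)
have h : 9 / 10 < exp (- (1 / 10)).
  by have := exp_ineq1 (- (1 / 10)) ltac:(lra); lra.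
have e10 : exp (- (1 / 10)) ^ 10 = / exp 1.
  rewrite -exp_Ropp -Rpower_pow; last exact: exp_pos.
  by rewrite /Rpower ln_exp; congr exp; rewrite /INR; lra.
have : (9 / 10) ^ 10 <= / exp 1 by rewrite -e10; apply: pow_incr; lra.
have e1 := exp_pos 1.
move=> /(Rmult_le_compat_r (exp 1) _ _ (Rlt_le _ _ e1)).
by rewrite Rinv_l; [simpl|]; lra.
Qed.

(** With [n = up_log 2 k], 2^(n-1) < k and ln 2 > 1/2 give n-1 < 2 ln k, and n <= 2(n-1) because n
    >= 2. *)
Lemma up_log_le_ln k : (2 < k)%N -> INR (up_log 2 k) <= 4 * ln (INR k).
Proof.
move=> k3; have /andP[lo _] := up_log_bounds (isT : 1 < 2)%N (ltnW k3).
have n2 : (2 <= up_log 2 k)%N.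
  have /andP[_ hi] := up_log_bounds (isT : 1 < 2)%N (ltnW k3).
  by case: (up_log 2 k) hi => [|[|?]] //; move: k3; case: k {lo} => [|[|[|?]]].
move: lo n2; set n := up_log 2 k => lo n2.
have pos2 : 0 < INR (2 ^ n.-1)%N.
  by apply/lt_0_INR/ssrnat.ltP; rewrite expn_gt0.
have h1 : ln (INR (2 ^ n.-1)%N) < ln (INR k).
  by apply: ln_increasing => //; apply/lt_INR/ssrnat.ltP.
have e2 m : INR (2 ^ m)%N = 2 ^ m.
  by elim: m => [//|m IH]; rewrite expnS mult_INR IH /=.
rewrite e2 ln_pow in h1; last lra.
have := ln_lt_2.
have en : INR n = INR n.-1 + 1 by rewrite -S_INR; congr INR; lia.
have : 1 <= INR n.-1 by apply: (le_INR 1); lia.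
rewrite en; nra.
Qed.

(** The exponent is [N + d]: the [d] factors [ln k] dominate the logarithms up to 4^d, and the other
    [N] satisfy (ln k)^N >= (ln 3)^N >= B * 4^d. *)
Lemma poly_log_bound (B d : nat) : exists c : R, forall k : nat, (2 < k)%N ->
  INR (B * up_log 2 k ^ d)%N <= Rpower (ln (INR k)) c.
Proof.
have l3 := ln3_gt1.
have [N hN] : exists N : nat, forall n : nat, (n >= N)%coq_nat ->
    Rabs (ln 3 ^ n) >= INR B * 4 ^ d.
  by apply: Pow_x_infinity; rewrite Rabs_right; lra.
exists (INR (N + d)) => k k3.
have lk : ln 3 <= ln (INR k).
  have : 3 <= INR k by have := le_INR 3 k (ssrnat.leP k3); rewrite /=; lra.
  by case=> [lt|<-]; [left; apply: ln_increasing; lra | right].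
rewrite Rpower_pow; last lra.
have en m : INR (up_log 2 k ^ m)%N = INR (up_log 2 k) ^ m.
  by elim: m => [//|m IH]; rewrite expnS mult_INR IH /=.
rewrite pow_add mult_INR en.
have h1 : INR B * 4 ^ d <= ln (INR k) ^ N.
  have := hN N (le_n _); rewrite Rabs_right; last by apply/Rle_ge/pow_le; lra.
  have := pow_incr (ln 3) (ln (INR k)) N ltac:(lra); lra.
have h2 : INR (up_log 2 k) ^ d <= 4 ^ d * ln (INR k) ^ d.
  rewrite -Rpow_mult_distr; apply: pow_incr.
  by split; [exact: pos_INR | exact: up_log_le_ln].
apply: Rle_trans (Rmult_le_compat_l _ _ _ (pos_INR B) h2) _.
rewrite -Rmult_assoc; apply: Rmult_le_compat_r h1.
by apply: pow_le; lra.
Qed.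
End RealBounds.

(** * Node labels of a topologically sorted circuit as recursive equations *)

Lemma topologicalP (R : comUnitRingType) (k : nat) (g0 : gate R k) gs :
  reflect (forall i j, (i < size gs)%N -> j \in children (nth g0 gs i) -> (j < i)%N)
    (topological gs).
Proof.
have sz : size (zip (iota 0 (size gs)) gs) = size gs.
  by rewrite size_zip size_iota minnn.
apply: (iffP (all_nthP (0%N, g0))); rewrite sz => h i.
  move=> j ilt; have := h i ilt.
  by rewrite nth_zip ?size_iota //= nth_iota // => /allP; apply.
move=> ilt; rewrite nth_zip ?size_iota //= nth_iota //.
by apply/allP => j; apply: h.
Qed.

Lemma size_node_labels (R : comUnitRingType) (k : nat) (T : Type)
    (step : seq T -> gate R k -> T) gs :
  size (node_labels step gs) = size gs.
Proof.
elim/last_ind: gs => [//|gs g IH].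
by rewrite /node_labels foldl_rcons !size_rcons -IH.
Qed.

Lemma node_labels_rcons (R : comUnitRingType) (k : nat) (T : Type)
    (step : seq T -> gate R k -> T) gs g :
  node_labels step (rcons gs g) =
    rcons (node_labels step gs) (step (node_labels step gs) g).
Proof. by rewrite /node_labels foldl_rcons. Qed.

(** When a label is computed, only the labels of earlier nodes are present. Children precede their
    node, so a step that looks only at children gives the same result on the complete list. *)
Lemma nth_node_labels (R : comUnitRingType) (k : nat) (T : Type) (x0 : T)
    (step : seq T -> gate R k -> T) (g0 : gate R k) gs i :
  (forall vs vs' g, {in children g, nth x0 vs =1 nth x0 vs'} ->
     step vs g = step vs' g) ->
  topological gs -> (i < size gs)%N ->
  nth x0 (node_labels step gs) i = step (node_labels step gs) (nth g0 gs i).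
Proof.
move=> local /(topologicalP g0).
elim/last_ind: gs => [//|gs g IH] top ilt.
have top' a b : (a < size gs)%N -> b \in children (nth g0 gs a) -> (b < a)%N.
  by move=> alt bch; apply: top; rewrite ?size_rcons ?nth_rcons ?alt ?ltnS 1?ltnW.
have step_eq a : (a <= size gs)%N ->
    step (node_labels step (rcons gs g)) (nth g0 (rcons gs g) a)
      = step (node_labels step gs) (nth g0 (rcons gs g) a).
  move=> ale; apply: local => j jch.
  have jlt : (j < a)%N by apply: top jch; rewrite size_rcons ltnS.
  by rewrite node_labels_rcons nth_rcons size_node_labels (leq_trans jlt ale).
rewrite size_rcons ltnS in ilt; rewrite step_eq // node_labels_rcons.
rewrite !nth_rcons size_node_labels.
by case: ltngtP ilt => // ilt _; apply: IH.
Qed.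

(** * Integral numerators and denominators of the gates at integer points *)

Section Fractions.
Variable k : nat.
Implicit Types (C : circuit rat k) (g : gate rat k) (e : 'I_k -> int).

(** Unreduced arithmetic on pairs of numerator and denominator. Denominator 1 at [Cst a] is correct
    for constant-free leaves, which are 0, 1 or -1. *)
Definition fraction_gate e (vs : seq (int * int)) g : int * int :=
  let u := nth (0, 1) vs in
  match g with
  | Var i => (e i, 1)
  | Cst a => (numq a, 1)
  | Add i j => ((u i).1 * (u j).2 + (u j).1 * (u i).2, (u i).2 * (u j).2)
  | Mul i j => ((u i).1 * (u j).1, (u i).2 * (u j).2)
  | Div i j => ((u i).1 * (u j).2, (u i).2 * (u j).1)
  end.

Definition fractions e (gs : seq (gate rat k)) : seq (int * int) :=
  node_labels (fraction_gate e) gs.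

Local Notation gate0 := (Cst 0 : gate rat k).
Local Notation gate_at C i := (nth gate0 (nodes C) i).
Local Notation value_at C i := (nth 0 (node_values (nodes C)) i).
Local Notation fraction_at e C i := (nth (0, 1) (fractions e (nodes C)) i).

Lemma value_atE C i : (i < size (nodes C))%N ->
  value_at C i = gate_value (node_values (nodes C)) (gate_at C i).
Proof.
move=> ilt; apply: nth_node_labels ilt; last exact: nodes_topological.
by move=> vs vs' [x|a|a b|a b|a b] //= h; rewrite !h // !inE eqxx ?orbT.
Qed.

Lemma fraction_atE e C i : (i < size (nodes C))%N ->
  fraction_at e C i = fraction_gate e (fractions e (nodes C)) (gate_at C i).
Proof.
move=> ilt; apply: nth_node_labels ilt; last exact: nodes_topological.
by move=> vs vs' [x|a|a b|a b|a b] //= h; rewrite !h // !inE eqxx ?orbT.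
Qed.

Lemma var_free_atE C i : (i < size (nodes C))%N ->
  nth true (nodes_var_free (nodes C)) i =
    gate_var_free (nodes_var_free (nodes C)) (gate_at C i).
Proof.
move=> ilt; apply: nth_node_labels ilt; last exact: nodes_topological.
by move=> vs vs' [x|a|a b|a b|a b] //= h; rewrite !h // !inE eqxx ?orbT.
Qed.

Lemma circuit_ind C (P : nat -> Prop) :
  (forall i, (i < size (nodes C))%N ->
     {in children (gate_at C i), forall j, (j < size (nodes C))%N /\ P j} ->
     P i) ->
  forall i, (i < size (nodes C))%N -> P i.
Proof.
move=> step; elim/ltn_ind => i IH ilt; apply: step => // j jch.
have jlt := topologicalP gate0 _ (nodes_topological C) i j ilt jch.
by split; [|apply: IH => //]; apply: ltn_trans ilt.
Qed.

Lemma var_free_const C i : (i < size (nodes C))%N ->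
  nth true (nodes_var_free (nodes C)) i -> exists c, value_at C i = c%:MP.
Proof.
move: i; apply: circuit_ind => i ilt IH; rewrite var_free_atE // value_atE //.
case: (gate_at C i) IH => [x|c|a b|a b|a b] //= IH; first by exists c.
all: move=> /andP[va vb].
all: have [alt /(_ va)[ca ->]] := IH a (mem_head _ _).
all: have [blt /(_ vb)[cb ->]] : (b < size (nodes C))%N /\ _
       := IH b (mem_last _ [:: b]).
- by exists (ca + cb); rewrite mpolyCD.
- by exists (ca * cb); rewrite mpolyCM.
- by eexists; rewrite -mul_mpolyC -mpolyCM.
Qed.

(** Makes [Div] a true division: a variable-free divisor is a constant polynomial, so the constant
    coefficient that is inverted is its whole value. *)
Lemma lawful_div C i a b : lawful_divisions C -> (i < size (nodes C))%N ->
  gate_at C i = Div a b ->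
  nth true (nodes_var_free (nodes C)) b /\
  exists2 c, c != 0 & value_at C b = c%:MP.
Proof.
move=> lawC ilt gi.
have blt : (b < size (nodes C))%N.
  apply: (ltn_trans _ ilt).
  apply: (topologicalP gate0 _ (nodes_topological C) i b ilt).
  by move: gi => /= ->; rewrite !inE eqxx orbT.
move/(all_nthP gate0)/(_ i ilt): lawC; rewrite /= gi => /andP[].
(* [lawful_divisions] reads the flags with default [false], [gate_var_free] with default [true];
   they agree because [b] is in range. *)
rewrite (set_nth_default true) ?size_node_labels // => vb nz; split=> //.
have [c ec] := var_free_const blt vb.
by exists c => //; rewrite -(mpolyC_eq0 k) -ec.
Qed.

Lemma leaf_const C i (a : rat) : constant_leaves C -> (i < size (nodes C))%N ->
  gate_at C i = Cst a -> a \in [:: 0; 1; -1].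
Proof. by move=> /(all_nthP gate0) lvs /lvs /= + gi; rewrite gi. Qed.

(** Induction over the circuit; the cross-multiplied form keeps each gate an identity of products,
    and only [Div] needs an inverse. *)
Lemma fraction_at_correct e C i : constant_free_over_rat C ->
  (i < size (nodes C))%N ->
  (fraction_at e C i).2 != 0 /\
  (fraction_at e C i).1%:~R =
    (fraction_at e C i).2%:~R * (value_at C i).@[fun x => (e x)%:~R] :> rat.
Proof.
move=> /andP[lawC leafC]; move: i; apply: circuit_ind => i ilt IH.
rewrite fraction_atE // value_atE //.
case gi: (gate_at C i) IH => [x|c|a b|a b|a b] /= IH.
- by rewrite mevalXU mul1r.
- rewrite mevalC mul1r; split=> //.
  by have := leaf_const leafC ilt gi; rewrite !inE => /or3P[] /eqP ->.
all: have [_ [na ea]] := IH a (mem_head _ _).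
all: have [_ [nb eb]] : (b < size (nodes C))%N /\ _ := IH b (mem_last _ [:: b]).
- rewrite mulf_neq0 // mevalD !rmorphD !rmorphM /= ea eb; split=> //.
  ring.
- by rewrite mulf_neq0 // mevalM !rmorphM /= ea eb mulrACA.
have [vb [c nc ec]] := lawful_div lawC ilt gi.
rewrite ec mevalC in eb; rewrite ec mcoeffC eqxx mulr1 mevalZ.
(* The divisor's numerator becomes a factor of the new denominator; it is the product of a nonzero
   denominator and the nonzero value [c]. *)
have nb1 : (fraction_at e C b).1 != 0.
  by rewrite -(intr_eq0 rat) eb mulf_neq0 // intr_eq0.
rewrite mulf_neq0 // !rmorphM /= ea eb; split=> //.
by field.
Qed.

(* The denominators do not depend on the point: a division multiplies by the
   numerator of a variable-free node. *)
Lemma fraction_at_congr e e' d C i : constant_free_over_rat C ->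
  (forall x, e x = e' x %[mod d])%Z ->
  (i < size (nodes C))%N ->
  [/\ (fraction_at e C i).2 = (fraction_at e' C i).2,
      ((fraction_at e C i).1 = (fraction_at e' C i).1 %[mod d])%Z
    & nth true (nodes_var_free (nodes C)) i ->
      (fraction_at e C i).1 = (fraction_at e' C i).1].
Proof.
move=> /andP[lawC leafC] ee'; move: i; apply: circuit_ind => i ilt IH.
rewrite !fraction_atE // var_free_atE //.
case gi: (gate_at C i) IH => [x|c|a b|a b|a b] //= IH.
all: have [_ [da ma va]] := IH a (mem_head _ _).
all: have [_ [db mb vb]] : (b < size (nodes C))%N /\ _ := IH b (mem_last _ [:: b]).
- rewrite da db; split=> // [|/andP[/va -> /vb ->] //].
  by rewrite -modzDm -(modzMm _.1) ma -(modzMm (fraction_at e C b).1) mb !modzMm modzDm.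
- rewrite da db; split=> // [|/andP[/va -> /vb ->] //].
  by rewrite -modzMm ma mb modzMm.
(* A congruence for the divisor's numerator would not suffice, since it enters the denominator; the
   third conjunct supplies equality. *)
- have [fb _] := lawful_div lawC ilt gi.
  rewrite da db (vb fb); split=> // [|/andP[/va -> _] //].
  by rewrite -modzMm ma modzMm.
Qed.

End Fractions.

(** * Straight-line programs over the integers and bounds on [tau] *)

(* Straight-line programs, recorded by the list of their intermediate values. *)
Inductive chain : seq int -> Prop :=
| chain_nil : chain [::]
| chain_const vs c : c \in [:: 0; 1; -1] -> chain vs -> chain (rcons vs c)
| chain_add vs a b : a \in vs -> b \in vs -> chain vs -> chain (rcons vs (a + b))
| chain_mul vs a b : a \in vs -> b \in vs -> chain vs -> chain (rcons vs (a * b)).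

Lemma topological_rcons (R : comUnitRingType) (k : nat) gs (g : gate R k) :
  topological gs -> {in children g, forall j, (j < size gs)%N} ->
  topological (rcons gs g).
Proof.
rewrite /topological size_rcons -addn1 iotaD add0n cats1 zip_rcons ?size_iota //.
by rewrite all_rcons /= => -> ch; rewrite andbT; apply/allP.
Qed.

Lemma chain_circuit vs : chain vs ->
  exists gs : seq (gate int 0), [/\ topological gs,
    all (fun g => if g is Div _ _ then false else true) gs,
    all (fun g => if g is Cst a then a \in [:: 0; 1; -1] else true) gs
    & node_values gs = [seq a%:MP_[0] | a <- vs]].
Proof.
elim=> {vs} [|vs c hc _|vs a b ha hb _|vs a b ha hb _]; first by exists [::].
all: move=> [gs [top df lvs val]].
all: have sz : size gs = size vs
       by rewrite -(size_node_labels (@gate_value int 0)) -/(node_values gs) val size_map.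
- exists (rcons gs (Cst c)); split; rewrite ?all_rcons ?hc //.
    exact: topological_rcons.
  by rewrite map_rcons -val /node_values node_labels_rcons.
(* A chain remembers values, not positions, so each child is taken to be the first node carrying the
   required value. *)
- exists (rcons gs (Add (index a vs) (index b vs))).
  split; rewrite ?all_rcons //.
    by apply: topological_rcons => // j; rewrite !inE sz => /orP[]/eqP->;
      rewrite index_mem.
  rewrite map_rcons -val /node_values node_labels_rcons -/(node_values gs) val /=.
  by rewrite !(nth_map 0) ?index_mem // !nth_index // mpolyCD.
- exists (rcons gs (Mul (index a vs) (index b vs))).
  split; rewrite ?all_rcons //.
    by apply: topological_rcons => // j; rewrite !inE sz => /orP[]/eqP->;
      rewrite index_mem.
  rewrite map_rcons -val /node_values node_labels_rcons -/(node_values gs) val /=.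
  by rewrite !(nth_map 0) ?index_mem // !nth_index // mpolyCM.
Qed.

Lemma tau_chain vs a : chain vs -> a \in vs -> (tau a <= size vs)%N.
Proof.
move=> /chain_circuit[gs [top df lvs val]] avs; rewrite /tau.
have sz : size gs = size vs.
  by rewrite -(size_node_labels (@gate_value int 0)) -/(node_values gs) val size_map.
case: ex_minnP => s _; apply; apply/asboolP.
have olt : (index a vs < size gs)%N by rewrite sz index_mem.
exists (Circuit top olt); split=> //; first exact/andP.
by rewrite /circuit_poly /= val (nth_map 0) ?index_mem // nth_index.
Qed.

Lemma chain_square vs a n : chain vs -> a \in vs ->
  exists vs', [/\ chain vs', a ^+ (2 ^ n) \in vs' & size vs' = (size vs + n)%N].
Proof.
move=> chvs avs; elim: n => [|n [vs' [ch' a' sz']]].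
  by exists vs; rewrite expr1 addn0.
exists (rcons vs' (a ^+ (2 ^ n) * a ^+ (2 ^ n))); split.
- exact: chain_mul.
- by rewrite -exprD addnn -mul2n -expnS mem_rcons mem_head.
- by rewrite size_rcons sz' addnS.
Qed.

(** Each gate is replaced by at most four integer operations; addition is the worst case, with two
    cross products, their sum and the product of denominators. At the point 0 the variables also
    become admissible constants. *)
Lemma chain_fractions (k : nat) (C : circuit rat k) :
  constant_free_over_rat C ->
  exists vs, [/\ chain vs, (size vs <= 4 * size (nodes C))%N
    & {in fractions (fun=> 0) (nodes C), forall u, u.1 \in vs /\ u.2 \in vs}].
Proof.
move=> cfC; have /andP[lawC leafC] := cfC.
set us := fractions _ _.
have szu : size us = size (nodes C) by rewrite size_node_labels.
suff [vs [chvs szvs h]] : exists vs, [/\ chain vs, (size vs <= 4 * size (nodes C))%N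
    & forall i, (i < size (nodes C))%N ->
        (nth (0, 1) us i).1 \in vs /\ (nth (0, 1) us i).2 \in vs].
  exists vs; split=> // u /(nthP (0, 1))[i]; rewrite szu => ilt <-.
  exact: h.
(* Induction on the length [t] of a prefix of the node list, the chain being extended for one gate
   at a time. *)
elim: {-2}(size _) (leqnn (size (nodes C))) => [|t IH] tle.
  by exists [::]; split=> //; exact: chain_nil.
have [vs [chvs szvs h]] := IH (ltnW tle).
suff [ws [chws szws sub uws]] : exists ws, [/\ chain ws, (size ws <= size vs + 4)%N,
    {subset vs <= ws}
    & (nth (0, 1) us t).1 \in ws /\ (nth (0, 1) us t).2 \in ws].
  exists ws; split=> // [|i].
    by apply: leq_trans szws _; rewrite mulnS addnC leq_add2l.
  by rewrite ltnS leq_eqVlt => /predU1P[->//|/h[? ?]]; split; apply: sub.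
pose g := nth (Cst 0) (nodes C) t.
have ch_in j : j \in children g ->
    (nth (0, 1) us j).1 \in vs /\ (nth (0, 1) us j).2 \in vs.
  by move=> jch; apply/h/(topologicalP _ _ (nodes_topological C) t j tle jch).
rewrite fraction_atE // -/g -/us.
case eg: g ch_in => [x|c|a b|a b|a b] ch_in /=.
all: try have [na da] := ch_in a (mem_head _ _).
all: try have [nb db] : _ /\ _ := ch_in b (mem_last _ [:: b]).
- exists (rcons (rcons vs 0) 1); split.
  + by do 2!apply: chain_const => //.
  + by rewrite !size_rcons -addn2 leq_add2l.
  + by move=> y yvs; rewrite !(mem_rcons, inE) yvs !orbT.
  + by rewrite !(mem_rcons, inE) !eqxx !orbT.
- exists (rcons (rcons vs (numq c)) 1); split.
  + do 2!apply: chain_const => //.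
    by have := leaf_const leafC tle eg; rewrite !inE => /or3P[]/eqP->.
  + by rewrite !size_rcons -addn2 leq_add2l.
  + by move=> y yvs; rewrite !(mem_rcons, inE) yvs !orbT.
  + by rewrite !(mem_rcons, inE) !eqxx !orbT.
- set n1 := (nth _ us a).1 in na *; set d1 := (nth _ us a).2 in da *.
  set n2 := (nth _ us b).1 in nb *; set d2 := (nth _ us b).2 in db *.
  exists (rcons (rcons (rcons (rcons vs (n1 * d2)) (n2 * d1)) (n1 * d2 + n2 * d1))
            (d1 * d2)).
  split.
  + apply: chain_mul; rewrite ?(mem_rcons, inE) ?da ?db ?orbT //.
    apply: chain_add; rewrite ?(mem_rcons, inE) ?eqxx ?orbT //.
    apply: chain_mul; rewrite ?(mem_rcons, inE) ?nb ?da ?orbT //.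
    exact: chain_mul.
  + by rewrite !size_rcons -addn4.
  + by move=> y yvs; rewrite !(mem_rcons, inE) yvs !orbT.
  + by rewrite !(mem_rcons, inE) !eqxx !orbT.
- exists (rcons (rcons vs ((nth (0, 1) us a).1 * (nth (0, 1) us b).1))
            ((nth (0, 1) us a).2 * (nth (0, 1) us b).2)).
  split.
  + apply: chain_mul; rewrite ?(mem_rcons, inE) ?da ?db ?orbT //.
    exact: chain_mul.
  + by rewrite !size_rcons -addn2 leq_add2l.
  + by move=> y yvs; rewrite !(mem_rcons, inE) yvs !orbT.
  + by rewrite !(mem_rcons, inE) !eqxx !orbT.
- exists (rcons (rcons vs ((nth (0, 1) us a).1 * (nth (0, 1) us b).2))
            ((nth (0, 1) us a).2 * (nth (0, 1) us b).1)).
  split.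
  + apply: chain_mul; rewrite ?(mem_rcons, inE) ?da ?nb ?orbT //.
    exact: chain_mul.
  + by rewrite !size_rcons -addn2 leq_add2l.
  + by move=> y yvs; rewrite !(mem_rcons, inE) yvs !orbT.
  + by rewrite !(mem_rcons, inE) !eqxx !orbT.
Qed.

(** * Evaluation at Boolean points and the divisors of the denominator *)

Lemma binary_digits n a : (a < 2 ^ n)%N -> (\sum_(i < n) 2 ^ i * odd (a %/ 2 ^ i))%N = a.
Proof.
elim: n a => [|n IH] a; first by rewrite big_ord0 expn0 ltnS leqn0 => /eqP.
move=> alt; rewrite big_ord_recl expn0 divn1 mul1n -[RHS]odd_double_half; congr (_ + _)%N.
rewrite -[in RHS](IH a./2); last by rewrite -divn2 ltn_divLR // mulnC -expnS.
rewrite -mul2n big_distrr; apply: eq_bigr => i _ /=.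
by rewrite /bump add1n expnS -mulnA -divn2 -divnMA.
Qed.

(** Both points have the binary digits of [a] as x and 0 as z; they differ only in y, which is
    [a.+1] in one and 0 in the other. The first matches the axioms: the BVP polynomial takes the
    value 1 + a there, and x^2 - x vanishes at bits. *)
Lemma boolean_ips_points (n : nat) (C : circuit rat (n + (1 + n))) (a : nat) :
  (a < 2 ^ n)%N -> boolean_ips_proof (BVP n) 1 C ->
  exists e e' : 'I_(n + (1 + n)) -> int,
    [/\ forall x, (e x = e' x %[mod a.+1])%Z,
        (circuit_poly C).@[fun x => (e x)%:~R] = 1
      & (circuit_poly C).@[fun x => (e' x)%:~R] = 0].
Proof.
move=> alt [C0 C1].
pose b (i : 'I_n) : int := odd (a %/ 2 ^ i).
pose point (y : int) (x : 'I_(n + (1 + n))) : int :=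
  match split x with inl i => b i | inr j => if split j is inl _ then y else 0 end.
pose v i : rat := (b i)%:~R.
have bvp : (tnth (BVP n) ord0).@[v] = a.+1%:R.
  rewrite (tnth_nth 0) /= mevalD meval1 raddf_sum /= -[in RHS](binary_digits alt).
  rewrite addrC -[RHS]natr1 natr_sum; congr (_ + _); apply: eq_bigr => i _.
  by rewrite mevalZ mevalXU natrM natrX.
have boolx i : (tnth (boolean_axioms rat n) i).@[v] = 0.
  rewrite tnth_mktuple mevalB rmorphXn /= mevalXU /v /b.
  by case: odd; rewrite ?expr1n ?expr0n subrr.
exists (point a.+1), (point 0); split.
- move=> x; rewrite /point; case: split => // j; case: split => // _.
  by rewrite modzz mod0z.
- rewrite -[RHS](meval1 v) -[in RHS]C1 comp_mpoly_meval; apply: meval_eq => x.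
  rewrite /point; case: split_ordP => [i ->|j ->].
    by rewrite tnth_lshift tnth_mktuple mevalXU.
  rewrite tnth_rshift; case: split_ordP => [i ->|i ->].
    by rewrite tnth_lshift ord1 bvp.
  by rewrite tnth_rshift boolx.
- rewrite -[RHS](meval0 v) -[in RHS]C0 comp_mpoly_meval; apply: meval_eq => x.
  rewrite /point; case: split_ordP => [i ->|j ->].
    by rewrite tnth_lshift tnth_mktuple mevalXU.
  rewrite tnth_rshift; case: split_ordP => [i ->|i ->].
    by rewrite tnth_lshift (tnth_nth 0) nth_nseq if_same meval0.
  by rewrite tnth_rshift (tnth_nth 0) nth_nseq if_same meval0.
Qed.

(** Each of the [n] factors of the factorial is matched with one copy of [M]. *)
Lemma fact_dvd_exp (M : int) (n : nat) :
  (forall j, (0 < j <= n)%N -> (j %| M)%Z) -> (n`! %| M ^+ n)%Z.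
Proof.
elim: n => [//|n IH] divM; rewrite factS exprS PoszM; apply: dvdz_mul.
  by apply: divM; rewrite leqnn.
by apply: IH => j /andP[j0 jn]; apply: divM; rewrite j0 leqW.
Qed.

Lemma refutation_denominator (n : nat) (C : circuit rat (n + (1 + n))) :
  constant_free_boolean_ips_refutation (BVP n) C ->
  exists M : int, [/\ M != 0,
    forall j, (0 < j <= 2 ^ n)%N -> (j %| M)%Z
    & (tau (M ^+ (2 ^ n)) <= 4 * circuit_size C + n)%N].
Proof.
move=> [cfC ipsC]; pose frac e := nth (0, 1) (fractions e (nodes C)) (output C).
have olt := output_lt C.
have den_eq e e' : (frac e).2 = (frac e').2.
  (* All points are congruent modulo 1, so [fraction_at_congr] applies to any pair and equates their
     denominators. *)
  have ee' x : (e x = e' x %[mod 1])%Z by rewrite !modz1.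
  by have [] := fraction_at_congr cfC ee' olt.
exists (frac (fun=> 0)).2; split.
- by have [] := fraction_at_correct (fun=> 0) cfC olt.
(* For j = a + 1, the numerator equals the denominator at [e] and vanishes at [e']; the two
   numerators are congruent modulo j. *)
- move=> [//|a] /= alt; have [e [e' [ee' Ce Ce']]] := boolean_ips_points alt ipsC.
  have [_] := fraction_at_correct e cfC olt; rewrite -/(circuit_poly C) Ce mulr1.
  move=> /intr_inj num_e.
  have [_] := fraction_at_correct e' cfC olt; rewrite -/(circuit_poly C) Ce' mulr0.
  move=> /eqP; rewrite intr_eq0 => /eqP num_e'.
  have [_ num_congr _] := fraction_at_congr cfC ee' olt.
  rewrite (den_eq _ e) /frac -num_e -[X in (_ %| X)%Z]subr0 -[X in _ - X]num_e'.
  by rewrite -eqz_mod_dvd num_congr.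
- have [vs [chvs szvs uvs]] := chain_fractions cfC.
  have [|_ Mvs] := uvs (frac (fun=> 0)); first by rewrite mem_nth ?size_node_labels.
  have [ws [chws Mws szws]] := chain_square n chvs Mvs.
  by apply: leq_trans (tau_chain chws Mws) _; rewrite szws leq_add2r.
Qed.

(** * Size bounds and the contradiction with the hypothesis *)

(** For n >= 1 every power of n occurring in q is at most n^(size q), so the sum of the absolute
    values of the coefficients, rounded up, serves as [B]. *)
Lemma poly_monomial_bound (q : {poly rat}) :
  exists B d : nat, forall n s : nat, (1 <= n)%N ->
    s%:R <= q.[n%:R] -> (s <= B * n ^ d)%N.
Proof.
pose S : rat := \sum_(i < size q) `|q`_i|.
have S0 : 0 <= S by rewrite sumr_ge0.
exists (Num.bound S), (size q) => n s n1 sq.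
rewrite -(ler_nat rat) natrM natrX; apply: (le_trans sq).
apply: (@le_trans _ _ (S * n%:R ^+ size q)); last first.
  by rewrite ler_wpM2r ?exprn_ge0 ?ler0n // ltW // archi_boundP.
rewrite horner_coef mulr_suml ler_sum // => i _.
apply: le_trans (ler_norm _) _; rewrite normrM ler_wpM2l //.
by rewrite normrX normr_nat ler_weXn2l ?ler1n // ltnW.
Qed.

Theorem theorem3p5 :
  Shub_Smale_hypothesis ->
  ~ exists q : {poly rat}, forall n : nat, (1 <= n)%N ->
      exists C : circuit rat (n + (1 + n)),
        constant_free_boolean_ips_refutation (BVP n) C
        /\ (circuit_size C)%:R <= q.[n%:R].
Proof.
move=> SS [q refq]; have [B [d qB]] := poly_monomial_bound q.
have multiple k : exists m : int, m != 0 /\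
    ((2 < k)%N -> (tau (m * (k`!)%:Z) <= (4 * B + 1) * up_log 2 k ^ d.+1)%N).
  (* Easiness constrains only indices above 2, so the multiplier 1 serves for the others. Above 2,
     [n] is chosen with k <= 2^n, whence k! divides (2^n)!. *)
  case: (ltnP 2 k) => [k3|]; last by exists 1.
  pose n := up_log 2 k; have n1 : (1 <= n)%N by rewrite up_log_gt0 (ltnW k3).
  have [C [refC szC]] := refq n n1.
  have [M [M0 divM tauM]] := refutation_denominator refC.
  have /dvdzP[m em] : (k`! %| M ^+ (2 ^ n))%Z.
    apply: dvdz_trans (fact_dvd_exp divM).
    by rewrite dvdzE (fact_split (up_logP k (isT : 1 < 2)%N)) dvdn_mulr.
  exists m; rewrite -em; split=> [|_].
    by apply: contraNneq M0 => m0; move/eqP: em; rewrite m0 mul0r expf_eq0 => /andP[].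
  (* The circuit contributes 4 B n^d and the squarings contribute n; both powers of n are raised to
     n^(d+1). *)
  apply: leq_trans tauM _; rewrite mulnDl mul1n leq_add //.
    rewrite -mulnA leq_mul2l /=; apply: leq_trans (qB _ _ n1 szC) _.
    by rewrite leq_mul2l leq_pexp2l ?orbT.
  by rewrite -[X in (X <= _)%N]expn1 leq_pexp2l.
(* The hypothesis speaks of a sequence, so one multiplier is chosen for every k. *)
have [m hm] := choice multiple.
apply: (SS m) => [k|]; first by have [] := hm k.
have [c hc] := poly_log_bound (4 * B + 1) d.+1.
exists c => k k3; apply: Rle_trans (hc k k3); apply/le_INR/ssrnat.leP.
by have [_] := hm k; apply.
Qed.
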